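(* Let $f=\frac1n\sum_{i=1}^n f_i$ with $f$ and each $f_i:\mathbb{R}^d\to\mathbb{R}$ convex and not necessarily smooth, and let $x^*$ be a minimizer of $f$. Assume interpolation, i.e. $f_i(x^* )=f_i^*:=\inf_xf_i(x)$ for every $i$. Let $G>0$ be a constant such that $\|g_i(x)\|^2<G^2$ for all $i\in\{1,\dots,n\}$, all $x\in\mathbb{R}^d$ and every subgradient $g_i(x)$ of $f_i$ at $x$. Then the iterates of the stochastic subgradient method with the subgradient counterpart of SPS with $c=1$ satisfy, for every $K\ge1$, $$\mathbb{E}\left[f(\bar{x}^K)-f(x^* )\right]\le\frac{G\|x^0-x^*\|}{\sqrt K}=O\left(\frac1{\sqrt K}\right),\qquad \bar{x}^K:=\frac1K\sum_{k=0}^{K-1}x^k.$$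
   Context: Setting: $f(x)=\frac1n\sum_{i=1}^n f_i(x)$ is minimized over $\mathbb{R}^d$, and the set of minimizers of $f$ is nonempty. Stochastic subgradient method: starting from a deterministic $x^0$, at each iteration $k$ an index $i\in\{1,\dots,n\}$ is drawn uniformly at random, independently of the past, and $x^{k+1}=x^k-\gamma_kg_i^k$, where $g_i^k=g_i(x^k)$ is a subgradient of $f_i$ at $x^k$. Subgradient counterpart of SPS with parameter $c>0$: $\gamma_k=\frac{f_i(x^k)-f_i^*}{c\|g_i^k\|^2}$, where $i$ is the index drawn at iteration $k$. If $g_i^k=0$ then $x^{k+1}=x^k$. *)

(* Defs.v *)
From HB Require Import structures.
From mathcomp Require Import all_boot all_order all_algebra.
From mathcomp Require Import all_classical all_reals all_analysis.
Set Implicit Arguments.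
Unset Strict Implicit.
Unset Printing Implicit Defensive.
Import Order.TTheory GRing.Theory Num.Theory.
Import numFieldNormedType.Exports.
Local Open Scope classical_set_scope.
Local Open Scope ring_scope.

Section Euclidean.
Context {R : realType} {d : nat}.
Implicit Types (u v x : 'rV[R]_d) (h : 'rV[R]_d -> R).

Definition dotv u v : R := \sum_(j < d) u 0 j * v 0 j.

(* The library norm on matrices is the sup norm, hence this definition. *)
Definition norm2 u : R := Num.sqrt (dotv u u).

Definition subgradient h x v : Prop :=
  forall y, h x + dotv v (y - x) <= h y.

(* Extended-real, so that it is -oo when h is not bounded below. *)
Definition infval h : \bar R := ereal_inf (range (fun x => (h x)%:E)).

Definition minimizer h x : Prop := forall y, h x <= h y.

End Euclidean.

Definition average {R : realType} {d n : nat}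
    (fs : 'I_n -> 'rV[R]_d -> R) (x : 'rV[R]_d) : R :=
  n%:R^-1 * \sum_(i < n) fs i x.

Section Method.
Context {R : realType} {d n : nat}.
Variables (fs : 'I_n -> 'rV[R]_d -> R) (g : 'I_n -> 'rV[R]_d -> 'rV[R]_d).

(* fine turns the infimum into a real number (-oo and +oo are sent to 0); under
   interpolation the infimum is attained, hence finite. *)
Definition sps_stepsize (c : R) (i : 'I_n) (x : 'rV[R]_d) : R :=
  (fs i x - fine (infval (fs i))) / (c * norm2 (g i x) ^+ 2).

Definition sps_step (c : R) (i : 'I_n) (x : 'rV[R]_d) : 'rV[R]_d :=
  if g i x == 0 then x else x - sps_stepsize c i x *: g i x.

(* k-th iterate when s l is the index drawn at iteration l. *)
Fixpoint sps_iter (c : R) (x0 : 'rV[R]_d) (s : nat -> 'I_n) (k : nat)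
    : 'rV[R]_d :=
  if k is k'.+1 then sps_step c (s k') (sps_iter c x0 s k') else x0.

End Method.

Definition iterate_mean {R : realType} {d : nat} (x : nat -> 'rV[R]_d)
    (K : nat) : 'rV[R]_d :=
  K%:R^-1 *: \sum_(k < K) x k.

Section Sampling.
Context {disp : measure_display} {T : measurableType disp} {R : realType}.
Variable P : probability T R.

Definition history {n : nat} (xi : nat -> T -> 'I_n) (k : nat) (w : T)
    : {ffun 'I_k -> 'I_n} :=
  [ffun l : 'I_k => xi l w].

(* 'I_n carries the discrete sigma-algebra; since history takes finitely many
   values, the sigma-algebra generated by the draws before time k consists of
   the events [history xi k \in A]. *)
Definition uniform_independent_draws {n : nat} (xi : nat -> T -> 'I_n) : Prop :=
  [/\ forall k i, measurable (xi k @^-1` [set i]),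
      forall k i, P (xi k @^-1` [set i]) = (n%:R^-1)%:E
    & forall k (A : {set {ffun 'I_k -> 'I_n}}) (B : {set 'I_n}),
        P ([set w | history xi k w \in A] `&` [set w | xi k w \in B]) =
        (P [set w | history xi k w \in A] * P [set w | xi k w \in B])%E].

End Sampling.

(* Main.v *)
Require Import Defs.
From HB Require Import structures.
From mathcomp Require Import all_boot all_order all_algebra.
From mathcomp Require Import all_classical all_reals all_analysis.
Import Order.TTheory GRing.Theory Num.Theory.
Import numFieldNormedType.Exports.
Local Open Scope classical_set_scope.
Local Open Scope ring_scope.
From mathcomp Require Import ring lra.

(** The guarantee is almost entirely deterministic.  Write
    [a k := fs i (x k) - fs i xs], where [i] is the index drawn at time [k].
    For [g != 0] the step [a k / |g|^2] is the one that minimizes the upper bound on the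
    squared distance to [xs] given by the subgradient inequality, and the
    distance then drops by at least [a k ^ 2 / |g|^2 >= a k ^ 2 / G^2]
    ([sps_step_descent]).  Telescoping gives
    [\sum_(k < K) a k ^ 2 <= G^2 * |x0 - xs|^2] along every sequence of draws, and
    by Cauchy-Schwarz the mean of [a 0], ..., [a K.-1] is at most
    [G * |x0 - xs| / sqrt K] ([sps_path_bound]).

    Probability enters only to replace [a k] by the gap of the average
    objective.  The iterate [x k] is a function of the draws before time [k], and
    the [k]-th draw is uniform and independent of them, so [a k] and
    [average fs (x k) - average fs xs] have the same expectation
    ([expectation_draw]).  All the random variables involved factor through the
    finitely many possible histories, so that expectations are finite sums and
    integrability is automatic.  Finally Jensen's inequality
    ([subgradient_mean_le]) passes from the mean of the values to the value at
    the mean iterate. *)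

Set Implicit Arguments.
Unset Strict Implicit.
Unset Printing Implicit Defensive.

(** * The Euclidean inner product *)

Section InnerProduct.
Context {R : realType} {d : nat}.
Implicit Types u v w : 'rV[R]_d.

Lemma dotvC u v : dotv u v = dotv v u.
Proof. by apply: eq_bigr => j _; rewrite mulrC. Qed.

Lemma dotvDr u v w : dotv u (v + w) = dotv u v + dotv u w.
Proof. by rewrite -big_split; apply: eq_bigr => j _ /=; rewrite mxE mulrDr. Qed.

Lemma dotvZr u a v : dotv u (a *: v) = a * dotv u v.
Proof. by rewrite mulr_sumr; apply: eq_bigr => j _; rewrite mxE mulrCA. Qed.

Lemma dotv0 u : dotv u 0 = 0.
Proof. by apply: big1 => j _; rewrite mxE mulr0. Qed.

Lemma dotv_sumr u K (x : 'I_K -> 'rV[R]_d) :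
  dotv u (\sum_k x k) = \sum_k dotv u (x k).
Proof. by elim/big_rec2: _ => [|k y z _ <-]; rewrite ?dotv0 ?dotvDr. Qed.

Lemma dotv_ge0 u : 0 <= dotv u u.
Proof. by apply: sumr_ge0 => j _; rewrite -expr2 sqr_ge0. Qed.

Lemma dotv_gt0 u : u != 0 -> 0 < dotv u u.
Proof.
move=> u0; rewrite lt_neqAle dotv_ge0 andbT eq_sym.
apply: contra u0 => /eqP u0; apply/eqP/rowP => j; rewrite mxE.
have /eqP := psumr_eq0P (fun j _ => sqr_ge0 (u 0 j)) u0 (i := j) isT.
by rewrite sqrf_eq0 => /eqP.
Qed.

Lemma norm2_sqr u : norm2 u ^+ 2 = dotv u u.
Proof. exact/sqr_sqrtr/dotv_ge0. Qed.

Lemma norm2_ge0 u : 0 <= norm2 u.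
Proof. exact: sqrtr_ge0. Qed.

Lemma norm2_sqrBZ u a v :
  norm2 (u - a *: v) ^+ 2 = norm2 u ^+ 2 - 2 * a * dotv v u + a ^+ 2 * dotv v v.
Proof.
rewrite !norm2_sqr -scaleNr dotvDr dotvZr ![dotv (u + _) _]dotvC !dotvDr !dotvZr.
rewrite (dotvC u v); ring.
Qed.

End InnerProduct.

(** * Jensen and Cauchy-Schwarz inequalities for finite means *)

(** Jensen's inequality: the affine minorant at the mean, averaged over the
    points, gives back its value at the mean because the deviations from the
    mean sum to zero. *)
Lemma subgradient_mean_le (R : realType) (d K : nat) (h : 'rV[R]_d -> R) v
    (x : nat -> 'rV[R]_d) :
  (0 < K)%N -> subgradient h (iterate_mean x K) v ->
  h (iterate_mean x K) <= K%:R^-1 * \sum_(k < K) h (x k).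
Proof.
move=> K0 hv; have KR : 0 < K%:R :> R by rewrite ltr0n.
have centered : \sum_(k < K) (x k - iterate_mean x K) = 0.
  rewrite sumrB sumr_const card_ord -scaler_nat scalerA divff ?gt_eqF//.
  by rewrite scale1r subrr.
have -> : h (iterate_mean x K) = K%:R^-1 *
    \sum_(k < K) (h (iterate_mean x K) + dotv v (x k - iterate_mean x K)).
  rewrite big_split /= -dotv_sumr centered dotv0 addr0 sumr_const card_ord.
  by rewrite -[h _ *+ K]mulr_natl mulKf ?gt_eqF.
by rewrite ler_wpM2l ?invr_ge0 ?ler0n//; apply: ler_sum => k _; exact: hv.
Qed.

(** Cauchy-Schwarz against the constant sequence [1], obtained from the
    nonnegativity of the variance of [a]. *)
Lemma sum_le_sqrt (R : realType) K (a : nat -> R) M :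
  0 <= M -> \sum_(k < K) a k ^+ 2 <= M ^+ 2 ->
  \sum_(k < K) a k <= Num.sqrt K%:R * M.
Proof.
move=> M0 aM.
have [->|K0] := posnP K; first by rewrite big_ord0 sqrtr0 mul0r.
have KR : 0 < K%:R :> R by rewrite ltr0n.
set S := \sum_(k < K) a k; set m := S / K%:R.
have : 0 <= \sum_(k < K) (a k - m) ^+ 2.
  by apply: sumr_ge0 => k _; exact: sqr_ge0.
have -> : \sum_(k < K) (a k - m) ^+ 2 =
    \sum_(k < K) a k ^+ 2 - S ^+ 2 / K%:R.
  under eq_bigr => k _.
    rewrite (_ : (a k - m) ^+ 2 = a k ^+ 2 + (a k * (- 2 * m) + m ^+ 2)).
      over.
    by ring.
  rewrite !big_split /= -mulr_suml sumr_const card_ord -/S -[_ *+ K]mulr_natl.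
  by congr (_ + _); rewrite /m; field; rewrite gt_eqF.
rewrite subr_ge0 => SK; apply: le_trans (ler_norm _) _.
rewrite -(@ler_pXn2r _ 2) ?nnegrE ?mulr_ge0 ?sqrtr_ge0//.
rewrite real_normK ?num_real// exprMn sqr_sqrtr ?ler0n// mulrC -ler_pdivrMr//.
exact: le_trans aM.
Qed.

(** * Descent along an arbitrary sequence of indices *)

Section Descent.
Context {R : realType} {d n : nat}.
Variables (fs : 'I_n -> 'rV[R]_d -> R) (g : 'I_n -> 'rV[R]_d -> 'rV[R]_d).
Variables (xs : 'rV[R]_d) (G : R).
Hypothesis interp : forall i, (fs i xs)%:E = infval (fs i).
Hypothesis subg : forall i x, subgradient (fs i) x (g i x).
Hypothesis bound : forall i x, norm2 (g i x) ^+ 2 < G ^+ 2.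

Lemma gap_ge0 i x : 0 <= fs i x - fs i xs.
Proof.
by rewrite subr_ge0 -lee_fin interp; apply: ereal_inf_lbound; exists x.
Qed.

(** With [a] the gap and [N := |g|^2], the subgradient inequality
    [a <= dotv g (x - xs)] makes the decrease of the squared distance at least
    [2 * (a / N) * a - (a / N)^2 * N = a^2 / N].  A zero subgradient means that
    [x] minimizes [fs i], so that both sides vanish. *)
Lemma sps_step_descent i x :
  (fs i x - fs i xs) ^+ 2 <=
  G ^+ 2 * (norm2 (x - xs) ^+ 2 - norm2 (sps_step fs g 1 i x - xs) ^+ 2).
Proof.
have gap0 := gap_ge0 i x; have := subg i x xs; rewrite /sps_step.
set a := fs i x - fs i xs in gap0 *.
have [-> | gN0] := eqVneq (g i x) 0.
  rewrite subrr mulr0 dotvC dotv0 addr0 -subr_le0 -/a => a_le0.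
  by rewrite (le_anti (introT andP (conj a_le0 gap0))) expr0n.
have N0 := dotv_gt0 gN0; have := bound i x; rewrite norm2_sqr.
set N := dotv _ _ in N0 *; move=> NG hs.
have {hs} gap_le : a <= dotv (g i x) (x - xs).
  have : dotv (g i x) (x - xs) = - dotv (g i x) (xs - x).
    by rewrite -[X in dotv _ X]opprB -scaleN1r dotvZr mulN1r.
  move=> ->; rewrite /a; lra.
have -> : sps_stepsize fs g 1 i x = a / N.
  by rewrite /sps_stepsize -interp /= mul1r norm2_sqr.
(* [addrAC] exposes [(x - xs) - (a / N) *: g i x]. *)
rewrite addrAC norm2_sqrBZ.
have -> : forall D p, D - (D - 2 * (a / N) * p + (a / N) ^+ 2 * N) =
    2 * (a / N) * p - a ^+ 2 / N by move=> D p; field; rewrite gt_eqF.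
have aN : 0 <= a / N by rewrite divr_ge0// ltW.
apply: (@le_trans _ _ (G ^+ 2 * (a ^+ 2 / N))).
  rewrite mulrCA ler_peMr ?sqr_ge0// ler_pdivlMr// mul1r; exact: ltW.
rewrite ler_wpM2l ?sqr_ge0// lerBrDr.
have -> : a ^+ 2 / N + a ^+ 2 / N = 2 * (a / N) * a by ring.
by rewrite ler_wpM2l// mulr_ge0.
Qed.

Lemma sps_path_bound x0 (s : nat -> 'I_n) K : (0 < K)%N -> 0 <= G ->
  K%:R^-1 * \sum_(k < K) (fs (s k) (sps_iter fs g 1 x0 s k) - fs (s k) xs) <=
  G * norm2 (x0 - xs) / Num.sqrt K%:R.
Proof.
move=> K0 G0; have KR : 0 < K%:R :> R by rewrite ltr0n.
pose D k := norm2 (sps_iter fs g 1 x0 s k - xs) ^+ 2.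
have energy :
    \sum_(k < K) (fs (s k) (sps_iter fs g 1 x0 s k) - fs (s k) xs) ^+ 2 <=
    (G * norm2 (x0 - xs)) ^+ 2.
  apply: (@le_trans _ _ (G ^+ 2 * (D 0%N - D K))); last first.
    by rewrite exprMn ler_wpM2l ?sqr_ge0// gerBl sqr_ge0.
  elim: (K) => [|k IHk]; first by rewrite big_ord0 subrr mulr0.
  rewrite big_ord_recr /= (le_trans (lerD IHk (sps_step_descent _ _)))//.
  by rewrite -mulrDr /D /= addrA subrK.
pose a k := fs (s k) (sps_iter fs g 1 x0 s k) - fs (s k) xs.
have := @sum_le_sqrt _ K a _ (mulr_ge0 G0 (norm2_ge0 (x0 - xs))) energy.
have sK : 0 < Num.sqrt K%:R :> R by rewrite sqrtr_gt0.
have -> : K%:R^-1 = (Num.sqrt K%:R)^-1 * (Num.sqrt K%:R)^-1 :> R.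
  by rewrite -invfM -expr2 sqr_sqrtr// ltW.
move=> le_sum; rewrite -[leLHS]mulrA [leLHS]mulrC ler_pM2r ?invr_gt0//.
by rewrite mulrC ler_pdivrMr// mulrC.
Qed.

End Descent.

(** * Random variables with finitely many values *)

Section FiniteRange.
Context {disp : measure_display} {T : measurableType disp} {R : realType}.
Variable P : probability T R.
Context {S : finType} (X : T -> S).
Hypothesis mX : forall s, measurable (X @^-1` [set s]).
Variable F : S -> R.

Let decomp : EFin \o (F \o X) =
  (fun w => \sum_s (F s)%:E * (\1_(X @^-1` [set s]) w)%:E)%E.
Proof.
apply/funext => w /=; rewrite (bigD1 (X w))//= indicE mem_set// mule1.
rewrite big1 ?adde0// => s sX; rewrite indicE memNset ?mule0//=.
by move=> Xs; rewrite Xs eqxx in sX.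
Qed.

Let integrable_term s :
  P.-integrable setT (fun w => (F s)%:E * (\1_(X @^-1` [set s]) w)%:E)%E.
Proof. by apply: integrableZl => //; exact: integrable_indic. Qed.

Lemma finite_range_Lfun : F \o X \in Lfun P 1.
Proof.
apply/Lfun1_integrable; rewrite decomp.
by apply: integrable_sum => // s _; exact: integrable_term.
Qed.

Lemma finite_range_expectation :
  ('E_P[F \o X] = \sum_s (F s)%:E * P (X @^-1` [set s]))%E.
Proof.
rewrite unlock -/(EFin \o _) [X in integral _ _ X]decomp integral_sum//.
apply: eq_bigr => s _; rewrite integralZl//; last exact: integrable_indic.
by rewrite integral_indic// setIT.
Qed.

End FiniteRange.

Lemma expectation_mono (disp : measure_display) (T : measurableType disp)
    (R : realType) (P : probability T R) (X Y : T -> R) :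
  X \in Lfun P 1 -> Y \in Lfun P 1 -> (forall w, X w <= Y w) ->
  ('E_P[X] <= 'E_P[Y])%E.
Proof.
move=> /Lfun1_integrable iX /Lfun1_integrable iY XY; rewrite unlock.
by apply: le_integral => // w _; rewrite lee_fin.
Qed.

(** * Uniform draws independent of the past *)

Section Draws.
Context {disp : measure_display} {T : measurableType disp} {R : realType}.
Variable P : probability T R.
Context {n : nat} (xi : nat -> T -> 'I_n).
Hypothesis draws : uniform_independent_draws P xi.

Lemma history_measurable k h : measurable (history xi k @^-1` [set h]).
Proof.
have [mxi _ _] := draws.
have -> : history xi k @^-1` [set h] =
    \bigcap_(l in [set: 'I_k]) (xi l @^-1` [set h l]).
  apply/seteqP; split => [w /= <- l _ | w hw]; first by rewrite /= ffunE.
  by apply/ffunP => l; rewrite ffunE; exact: hw.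
by apply: fin_bigcap_measurable => // l _; exact: mxi.
Qed.

Let joint k (w : T) := (history xi k w, xi k w).

Let joint_preimage k h i : joint k @^-1` [set (h, i)] =
  history xi k @^-1` [set h] `&` xi k @^-1` [set i].
Proof. by apply/seteqP; split => w; rewrite /joint /= => -[-> ->]. Qed.

Let joint_measurable k hi : measurable (joint k @^-1` [set hi]).
Proof.
have [mxi _ _] := draws; case: hi => h i; rewrite joint_preimage.
by apply: measurableI; [exact: history_measurable | exact: mxi].
Qed.

Lemma joint_law k h i : P (joint k @^-1` [set (h, i)]) =
  (P (history xi k @^-1` [set h]) * (n%:R^-1)%:E)%E.
Proof.
have [_ unif indep] := draws; rewrite joint_preimage -(unif k i).
have := indep k [set h]%SET [set i]%SET.
rewrite (_ : [set w | history xi k w \in [set h]%SET] =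
  history xi k @^-1` [set h]); last first.
  by apply/seteqP; split => w /=; rewrite inE => /eqP.
rewrite (_ : [set w | xi k w \in [set i]%SET] = xi k @^-1` [set i])//.
by apply/seteqP; split => w /=; rewrite inE => /eqP.
Qed.

Lemma history_Lfun k (F : {ffun 'I_k -> 'I_n} -> R) :
  (fun w => F (history xi k w)) \in Lfun P 1.
Proof. exact: (finite_range_Lfun P (@history_measurable k)). Qed.

Lemma joint_Lfun k (F : {ffun 'I_k -> 'I_n} -> 'I_n -> R) :
  (fun w => F (history xi k w) (xi k w)) \in Lfun P 1.
Proof.
exact: (finite_range_Lfun P (@joint_measurable k) (fun p => F p.1 p.2)).
Qed.

(** Averaging over the current draw, which is uniform given the history.  This
    is the tower property: with finitely many histories, it is the factorization
    [joint_law] of the weights in a finite sum. *)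
Lemma expectation_draw k (F : {ffun 'I_k -> 'I_n} -> 'I_n -> R) :
  ('E_P[fun w => F (history xi k w) (xi k w)] =
   'E_P[fun w => (n%:R^-1 * \sum_i F (history xi k w) i)%R])%E.
Proof.
have := finite_range_expectation P (@joint_measurable k) (fun p => F p.1 p.2).
rewrite [X in ('E_P[X])%E](_ : _ = fun w => F (history xi k w) (xi k w))// => ->.
have := finite_range_expectation P (@history_measurable k)
  (fun h => n%:R^-1 * \sum_i F h i).
rewrite [X in ('E_P[X])%E](_ : _ = fun w => n%:R^-1 * \sum_i F (history xi k w) i)//.
move=> ->.
transitivity (\sum_h \sum_i (F h i)%:E * P (joint k @^-1` [set (h, i)]))%E.
  by rewrite pair_bigA; apply: eq_bigr => -[h i].
apply: eq_bigr => h _.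
under eq_bigr do rewrite joint_law.
have /fineK <- : P (history xi k @^-1` [set h]) \is a fin_num.
  by rewrite fin_num_measure//; exact: history_measurable.
under eq_bigr do rewrite -!EFinM.
rewrite sumEFin -EFinM; congr EFin; rewrite mulr_sumr mulr_suml.
by apply: eq_bigr => i _; ring.
Qed.

End Draws.

(** * Iterates as functions of the history *)

Section Extension.
Context {n : nat} (i0 : 'I_n).

(** The iterates take an infinite sequence of indices; padding a finite history
    by [i0] turns them into functions of the history alone. *)
Definition extend k (h : {ffun 'I_k -> 'I_n}) (l : nat) : 'I_n :=
  if insub l is Some j then h j else i0.

Lemma sps_iter_history (R : realType) d (fs : 'I_n -> 'rV[R]_d -> R) g c x0
    disp (T : measurableType disp) (xi : nat -> T -> 'I_n) k m w : (k <= m)%N ->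
  sps_iter fs g c x0 (xi^~ w) k =
  sps_iter fs g c x0 (extend (history xi m w)) k.
Proof.
elim: k => //= k IHk km; rewrite IHk 1?ltnW//; congr sps_step.
by rewrite /extend insubT /= ffunE.
Qed.

Lemma iterate_mean_history (R : realType) d (fs : 'I_n -> 'rV[R]_d -> R) g c x0
    disp (T : measurableType disp) (xi : nat -> T -> 'I_n) K w :
  iterate_mean (sps_iter fs g c x0 (xi^~ w)) K =
  iterate_mean (sps_iter fs g c x0 (extend (history xi K w))) K.
Proof.
congr (_ *: _); apply: eq_bigr => k _.
by rewrite -sps_iter_history// ltnW.
Qed.

End Extension.

(** * The convergence rate *)

Lemma bigO_scale (R : realType) (c : R) (u : nat -> R) :
  (fun K => c * u K : R^o) =O_\oo (u : nat -> R^o).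
Proof.
apply/eqOP; near=> M => /=; near=> K.
rewrite normrM ler_wpM2r//; near: M; exact: nbhs_pinfty_ge.
Unshelve. all: by end_near. Qed.

Theorem theoremC1 (R : realType) (d n : nat) (hn : (0 < n)%N)
    (fs : 'I_n -> 'rV[R]_d -> R)
    (hfs : forall i : 'I_n, convex_function [set: 'rV[R]_d] (fs i))
    (hf : convex_function [set: 'rV[R]_d] (average fs))
    (xs : 'rV[R]_d) (hxs : minimizer (average fs) xs)
    (hinterp : forall i : 'I_n, (fs i xs)%:E = infval (fs i))
    (G : R) (hG : 0 < G)
    (hbound : forall (i : 'I_n) (x v : 'rV[R]_d),
        subgradient (fs i) x v -> norm2 v ^+ 2 < G ^+ 2)
    (g : 'I_n -> 'rV[R]_d -> 'rV[R]_d)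
    (hg : forall (i : 'I_n) (x : 'rV[R]_d), subgradient (fs i) x (g i x))
    (x0 : 'rV[R]_d)
    (disp : measure_display) (T : measurableType disp) (P : probability T R)
    (xi : nat -> T -> 'I_n) (hxi : uniform_independent_draws P xi) :
  (forall K : nat, (1 <= K)%N ->
     ('E_P[fun w : T =>
         (average fs (iterate_mean (sps_iter fs g 1 x0 (fun k => xi k w)) K)
          - average fs xs)%R]
      <= (G * norm2 (x0 - xs) / Num.sqrt K%:R)%:E)%E)
  /\ (fun K : nat => G * norm2 (x0 - xs) / Num.sqrt K%:R : R^o)
       =O_\oo (fun K : nat => 1 / Num.sqrt K%:R : R^o).
Proof.
split; last first.
  have := bigO_scale (G * norm2 (x0 - xs)) (fun K => 1 / Num.sqrt K%:R).
  by under eq_fun do rewrite mulrA mulr1.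
move=> K K0.
pose i0 : 'I_n := Ordinal hn.
pose x w := sps_iter fs g 1 x0 (xi^~ w).
pose Y k w := average fs (x w k) - average fs xs.
pose Z k w := fs (xi k w) (x w k) - fs (xi k w) xs.
have bound i y : norm2 (g i y) ^+ 2 < G ^+ 2 by exact: hbound (hg i y).
(* Integrability: both gaps are functions of a history, or of a history and
   the next draw. *)
have YL k : Y k \in Lfun P 1.
  have := history_Lfun hxi (fun h : {ffun 'I_k -> 'I_n} =>
    average fs (sps_iter fs g 1 x0 (extend i0 h) k) - average fs xs).
  by under eq_fun do rewrite -sps_iter_history//.
have ZL k : Z k \in Lfun P 1.
  have := joint_Lfun hxi (fun (h : {ffun 'I_k -> 'I_n}) i =>
    fs i (sps_iter fs g 1 x0 (extend i0 h) k) - fs i xs).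
  by under eq_fun do rewrite -sps_iter_history//.
(* Conditionally on the history, the drawn gap averages to the gap of
   [average fs]. *)
have EYZ k : ('E_P[Y k] = 'E_P[Z k])%E.
  have := expectation_draw hxi (fun (h : {ffun 'I_k -> 'I_n}) i =>
    fs i (sps_iter fs g 1 x0 (extend i0 h) k) - fs i xs).
  under eq_fun do rewrite -sps_iter_history//.
  move=> ->; congr expectation; apply/funext => w.
  by rewrite -sps_iter_history// sumrB mulrBr.
have sumL (U : nat -> T -> R) m : (forall k, U k \in Lfun P 1) ->
    (fun w => \sum_(k < m) U k w) \in Lfun P 1.
  move=> UL; rewrite -fct_sumE; exact: rpred_sum.
have Esum m : ('E_P[fun w => (\sum_(k < m) Y k w)%R] =
    'E_P[fun w => (\sum_(k < m) Z k w)%R])%E.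
  elim: m => [|m IHm].
    under eq_fun do rewrite big_ord0.
    by under [in RHS]eq_fun do rewrite big_ord0.
  under eq_fun do rewrite big_ord_recr.
  under [in RHS]eq_fun do rewrite big_ord_recr.
  rewrite (expectationD (X := fun w => \sum_(k < m) Y k w)) ?sumL//.
  by rewrite (expectationD (X := fun w => \sum_(k < m) Z k w)) ?sumL// IHm EYZ.
(* The subgradients of the components at the mean iterate are used one index at
   a time, hence the exchange of the sums over indices and iterations. *)
have jensen w : average fs (iterate_mean (x w) K) - average fs xs <=
    K%:R^-1 * \sum_(k < K) Y k w.
  rewrite sumrB sumr_const card_ord mulrBr -[average _ _ *+ K]mulr_natl.
  rewrite mulKf ?gt_eqF ?ltr0n//.
  rewrite lerB// /average -mulr_sumr mulrCA ler_wpM2l ?invr_ge0 ?ler0n//.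
  rewrite exchange_big mulr_sumr; apply: ler_sum => i _.
  exact: subgradient_mean_le (hg _ _).
have XL : (fun w => average fs (iterate_mean (x w) K) - average fs xs)
    \in Lfun P 1.
  have := history_Lfun hxi (fun h : {ffun 'I_K -> 'I_n} =>
    average fs (iterate_mean (sps_iter fs g 1 x0 (extend i0 h)) K)
    - average fs xs).
  by under eq_fun do rewrite -iterate_mean_history.
have scaleL (U : T -> R) : U \in Lfun P 1 ->
    (fun w => K%:R^-1 * U w) \in Lfun P 1.
  move=> UL; rewrite (_ : (fun w => _) = K%:R^-1 \o* U) ?Lfun_scale//.
  by apply/funext => w /=; rewrite mulrC.
have scaleE (U : T -> R) : U \in Lfun P 1 ->
    ('E_P[fun w => (K%:R^-1 * U w)%R] = (K%:R^-1)%:E * 'E_P[U])%E.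
  move=> UL; rewrite -expectationZl//; congr expectation.
  by apply/funext => w /=; rewrite mulrC.
apply: (le_trans (expectation_mono XL (scaleL _ (sumL _ K YL)) jensen)).
rewrite scaleE ?sumL// Esum -scaleE ?sumL// -(expectation_cst P).
apply: expectation_mono => [||w]; rewrite ?scaleL ?sumL ?Lfun_cst//.
exact: (sps_path_bound hinterp hg bound _ _ K0 (ltW hG)).
Qed.
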